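(* Let $0\le p_c\le p_d\le 1$. For $\delta_1,\delta_2\in[0,1]$ let $R_{sum}(\delta_1,\delta_2)$ be the Han–Kobayashi sum-rate with time-sharing defined in the context. Then $$\max_{\delta_1,\delta_2\in[0,1]} R_{sum}(\delta_1,\delta_2)=\begin{cases}2p_d(1-p_c) & \text{if } p_c\le \frac{p_d}{1+p_d},\\ p_d+p_c-p_dp_c+\frac{p_d-p_c}{2}C_\delta^* & \text{if } \frac{p_d}{1+p_d}<p_c\le p_d,\end{cases}$$ where $C_\delta^*=\frac{p_dp_c-(p_d-p_c)}{p_dp_c-\frac{p_d-p_c}{2}}$.
   Context: Channel (single-letter): $Y_1=G_{11}X_1\oplus G_{21}X_2$, $Y_2=G_{22}X_2\oplus G_{12}X_1$ over $\mathbb{F}_2$, with $G_{11},G_{22}\sim\mathcal{B}(p_d)$, $G_{12},G_{21}\sim\mathcal{B}(p_c)$ mutually independent and independent of the inputs; $\mathcal{B}(p)$ is Bernoulli with $\Pr(1)=p$. Scheme: $Q$ is uniform on $\{1,2\}$ (a time-sharing variable known to all). Given $Q$, the variables $X_{1c},X_{1p},X_{2c},X_{2p}$ are conditionally independent with: if $Q=1$, $X_{1c}\sim\mathcal{B}(\delta_1/2)$, $X_{1p}\sim\mathcal{B}(1-\frac{1}{2-\delta_1})$, $X_{2c}\sim\mathcal{B}(\delta_2/2)$, $X_{2p}\sim\mathcal{B}(1-\frac{1}{2-\delta_2})$; if $Q=2$, the roles of $\delta_1,\delta_2$ are swapped. The inputs are $X_i=\max(X_{ic},X_{ip})$ (so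 $X_i\sim\mathcal{B}(1/2)$). Let $\mathbf{G}_1=(G_{11},G_{21})$, $\mathbf{G}_2=(G_{22},G_{12})$. Define $R_{sum}(\delta_1,\delta_2)$ as the maximum of $R_{1c}+R_{1p}+R_{2c}+R_{2p}$ over nonnegative rates satisfying, for $i=1,2$: $R_{ip}\le I(X_{ip};Y_i\mid X_{1c},X_{2c},Q,\mathbf{G}_i)$, and for each $j=1,2$: $R_{1c}+R_{2c}\le I(X_{1c},X_{2c};Y_j\mid Q,\mathbf{G}_j)$, $R_{1c}\le I(X_{1c};Y_j\mid X_{2c},Q,\mathbf{G}_j)$, $R_{2c}\le I(X_{2c};Y_j\mid X_{1c},Q,\mathbf{G}_j)$ (i.e. both common messages are decoded at both receivers and each private message is decoded last at its own receiver). *)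

(* Defs.v *)
From HB Require Import structures.
From mathcomp Require Import all_boot all_order all_algebra.
From mathcomp Require Import classical_sets reals exp.
Set Implicit Arguments. Unset Strict Implicit. Unset Printing Implicit Defensive.
Import Order.TTheory GRing.Theory Num.Theory.
Local Open Scope ring_scope.
Local Open Scope classical_set_scope.

Section Info.
Variable R : realType.

(* Sample space: (Q, X1c, X1p, X2c, X2p, G11, G12, G21, G22), all bits.
   Q = false encodes time-sharing index 1, Q = true encodes index 2. *)
Definition Omega := (bool * bool * bool * bool * bool * bool * bool * bool * bool)%type.

Definition vQ   (w : Omega) : bool := let: (q,_,_,_,_,_,_,_,_) := w in q.
Definition vX1c (w : Omega) : bool := let: (_,a,_,_,_,_,_,_,_) := w in a.
Definition vX1p (w : Omega) : bool := let: (_,_,a,_,_,_,_,_,_) := w in a.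
Definition vX2c (w : Omega) : bool := let: (_,_,_,a,_,_,_,_,_) := w in a.
Definition vX2p (w : Omega) : bool := let: (_,_,_,_,a,_,_,_,_) := w in a.
Definition vG11 (w : Omega) : bool := let: (_,_,_,_,_,a,_,_,_) := w in a.
Definition vG12 (w : Omega) : bool := let: (_,_,_,_,_,_,a,_,_) := w in a.
Definition vG21 (w : Omega) : bool := let: (_,_,_,_,_,_,_,a,_) := w in a.
Definition vG22 (w : Omega) : bool := let: (_,_,_,_,_,_,_,_,a) := w in a.

Definition vX1 (w : Omega) : bool := vX1c w || vX1p w.
Definition vX2 (w : Omega) : bool := vX2c w || vX2p w.
Definition vY1 (w : Omega) : bool := (vG11 w && vX1 w) (+) (vG21 w && vX2 w).
Definition vY2 (w : Omega) : bool := (vG22 w && vX2 w) (+) (vG12 w && vX1 w).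
Definition vGG1 (w : Omega) : bool * bool := (vG11 w, vG21 w).
Definition vGG2 (w : Omega) : bool * bool := (vG22 w, vG12 w).

Definition bern (p : R) (b : bool) : R := if b then p else 1 - p.

Definition Pjoint (pd pc d1 d2 : R) (w : Omega) : R :=
  let: (q, x1c, x1p, x2c, x2p, g11, g12, g21, g22) := w in
  let a1 := if q then d2 else d1 in
  let a2 := if q then d1 else d2 in
  2^-1 * bern (a1 / 2) x1c * bern (1 - (2 - a1)^-1) x1p
       * bern (a2 / 2) x2c * bern (1 - (2 - a2)^-1) x2p
       * bern pd g11 * bern pc g12 * bern pc g21 * bern pd g22.

Definition pmf_of (P : Omega -> R) (T : finType) (f : Omega -> T) (t : T) : R :=
  \sum_(w : Omega | f w == t) P w.

Definition xlog2x (x : R) : R := if x == 0 then 0 else x * (ln x / ln 2).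

Definition entropy (P : Omega -> R) (T : finType) (f : Omega -> T) : R :=
  - \sum_(t : T) xlog2x (pmf_of P f t).

Definition cmi (P : Omega -> R) (A B C : finType)
    (f : Omega -> A) (g : Omega -> B) (h : Omega -> C) : R :=
  entropy P (fun w => (f w, h w)) + entropy P (fun w => (g w, h w))
  - entropy P (fun w => (f w, g w, h w)) - entropy P h.

(* Han-Kobayashi rate constraints (both common messages decoded at both receivers) *)
Definition HK_feasible (pd pc d1 d2 : R) (r1c r1p r2c r2p : R) : Prop :=
  let P := Pjoint pd pc d1 d2 in
  [/\ 0 <= r1c, 0 <= r1p, 0 <= r2c & 0 <= r2p] /\
  r1p <= cmi P vX1p vY1 (fun w => (vX1c w, vX2c w, vQ w, vGG1 w)) /\
  r2p <= cmi P vX2p vY2 (fun w => (vX1c w, vX2c w, vQ w, vGG2 w)) /\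
  r1c + r2c <= cmi P (fun w => (vX1c w, vX2c w)) vY1 (fun w => (vQ w, vGG1 w)) /\
  r1c <= cmi P vX1c vY1 (fun w => (vX2c w, vQ w, vGG1 w)) /\
  r2c <= cmi P vX2c vY1 (fun w => (vX1c w, vQ w, vGG1 w)) /\
  r1c + r2c <= cmi P (fun w => (vX1c w, vX2c w)) vY2 (fun w => (vQ w, vGG2 w)) /\
  r1c <= cmi P vX1c vY2 (fun w => (vX2c w, vQ w, vGG2 w)) /\
  r2c <= cmi P vX2c vY2 (fun w => (vX1c w, vQ w, vGG2 w)).

(* R_sum(d1, d2): the maximum (supremum of the compact feasible polytope) of the sum rate *)
Definition Rsum (pd pc d1 d2 : R) : R :=
  sup [set s : R | exists r1c r1p r2c r2p,
         HK_feasible pd pc d1 d2 r1c r1p r2c r2p /\ s = r1c + r1p + r2c + r2p].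

Definition Cstar (pd pc : R) : R :=
  (pd * pc - (pd - pc)) / (pd * pc - (pd - pc) / 2).

End Info.

(* Main.v *)
Require Import Defs.
From HB Require Import structures.
From mathcomp Require Import all_boot all_order all_algebra.
From mathcomp Require Import classical_sets reals exp.
From mathcomp Require Import topology normedtype.
From mathcomp Require Import ring lra.
Import Order.TTheory GRing.Theory Num.Theory.
Import numFieldNormedType.Exports.
Local Open Scope ring_scope.
Set Implicit Arguments.
Unset Strict Implicit.
Unset Printing Implicit Defensive.

(* Every mutual information in the constraints is a difference of conditional
   entropies of a binary output, so the rate region depends on (d1, d2) only
   through M = (H(X1|X1c) + H(X2|X2c)) / 2 and S = H(X1 + X2 | X1c, X2c); the
   time-sharing variable symmetrises the two users.  The sum of the private
   rates is at most 2 pd ((1 - 2 pc) M + pc S).  Adding twice the cross-link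
   bound on a common rate removes S and gives
   2 pc + 2 (pd - pc - pd pc) M; adding the joint bound on the common rates and
   using S <= 2 M gives pd + pc - pd pc + (pd - pc) M.  If
   pc <= pd / (1 + pd) the first bound is maximal at M = 1, attained at
   d1 = d2 = 0.  Otherwise the first bound decreases and the second increases
   in M; they cross at M = Cstar / 2, attained at d1 = 1 and, by the
   intermediate value theorem, some d2 with H(X2|X2c) = Cstar, where S = 2 M. *)

(** * Entropy calculus: recoding, the chain rule, and conditional entropy of a binary output *)

Section Entropy.
Variable R : realType.
Implicit Types (P : Omega -> R) (x y p q : R).

Lemma xlog2x0 : xlog2x (0 : R) = 0.
Proof. by rewrite /xlog2x eqxx. Qed.

(** The convention [xlog2x 0 = 0] keeps the product rule valid at zero factors, so cells of
    probability zero require no separate treatment. *)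
Lemma xlog2xM x y : 0 <= x -> 0 <= y ->
  xlog2x (x * y) = x * xlog2x y + y * xlog2x x.
Proof.
rewrite !le_eqVlt => /predU1P[<-|x0] /predU1P[<-|y0];
  rewrite ?(mul0r, mulr0) ?xlog2x0 ?(mul0r, mulr0, addr0) //.
rewrite /xlog2x mulf_eq0 !gt_eqF //= lnM ?posrE //; ring.
Qed.

Definition hb p : R := - (xlog2x p + xlog2x (1 - p)).

Definition cond_ent P (U T : finType) (Y : Omega -> U) (Z : Omega -> T) : R :=
  entropy P (fun w => (Y w, Z w)) - entropy P Z.

Lemma eq_entropy P (T : finType) (f g : Omega -> T) :
  f =1 g -> entropy P f = entropy P g.
Proof.
move=> fg; congr (- _); apply: eq_bigr => t _; congr xlog2x.
by apply: eq_bigl => w; rewrite fg.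
Qed.

(** Values outside the image of [f] have probability zero and contribute [xlog2x 0 = 0]; on the
    image the sum is only reindexed. *)
Lemma entropy_recode P (T U : finType) (f : T -> U) (Z : Omega -> T) :
  injective f -> entropy P (fun w => f (Z w)) = entropy P Z.
Proof.
move=> finj; congr (- _).
rewrite (bigID [in f @: [set: T]]) /= [X in _ + X]big1 ?addr0; last first.
  move=> u /imsetP nu; rewrite [pmf_of _ _ _]big_pred0 ?xlog2x0 // => w.
  by apply/eqP => fu; apply: nu; exists (Z w); rewrite ?inE.
rewrite big_imset /=; last by move=> ? ? _ _; exact: finj.
apply: eq_big => [t|t _]; first by rewrite !inE.
by congr xlog2x; apply: eq_bigl => w; rewrite (inj_eq finj).
Qed.

(** Reduces every rate bound to conditional entropies of an output bit; [rot] moves [g] to the front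
    of the triple. *)
Lemma cmiE P (A B C : finType)
    (f : Omega -> A) (g : Omega -> B) (h : Omega -> C) :
  cmi P f g h = cond_ent P g h - cond_ent P g (fun w => (f w, h w)).
Proof.
pose rot (t : A * B * C) := (t.1.2, (t.1.1, t.2)).
have rot_inj : injective rot by move=> [[? ?] ?] [[? ?] ?] [-> -> ->].
rewrite /cmi /cond_ent -(entropy_recode P (fun w => (f w, g w, h w)) rot_inj) /=.
lra.
Qed.

Lemma cond_ent_recode P (U T V : finType) (f : T -> V)
    (Y : Omega -> U) (Z : Omega -> T) :
  injective f -> cond_ent P Y (fun w => f (Z w)) = cond_ent P Y Z.
Proof.
move=> finj; pose g (t : U * T) := (t.1, f t.2).
have ginj : injective g by move=> [? ?] [? ?] [-> /finj ->].
by rewrite /cond_ent -(entropy_recode P _ ginj) (entropy_recode P Z finj).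
Qed.

(* [th] reorders the coordinates into those fixing [Z], those [Y] still depends
   on, and those irrelevant to both. *)
Lemma cond_ent_fiber P (A B C : finType) (th : A * B * C -> Omega)
    (p : A -> R) (m : A -> B -> R) (n : C -> R)
    (V : finType) (z : A -> V) (y : A -> B -> bool)
    (Y : Omega -> bool) (Z : Omega -> V) :
  bijective th ->
  (forall a b c, P (th (a, b, c)) = p a * m a b * n c) ->
  (forall a, 0 <= p a) -> (forall a b, 0 <= m a b) ->
  (forall a, \sum_b m a b = 1) -> \sum_c n c = 1 ->
  injective z -> (forall a b c, Z (th (a, b, c)) = z a) ->
  (forall a b c, Y (th (a, b, c)) = y a b) ->
  cond_ent P Y Z = \sum_a p a * hb (\sum_(b | y a b) m a b).
Proof.
move=> [th' thK th'K] PE p0 m0 m1 n1 zinj ZE YE.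
have th_bij : bijective th by exists th'.
pose Z' w := (th' w).1.1.
have ZZ' w : Z w = z (Z' w).
  by rewrite /Z' -{1}(th'K w); case: (th' w) => [[a b] c]; rewrite ZE.
have -> : cond_ent P Y Z = cond_ent P Y Z'.
  rewrite -(cond_ent_recode P Y Z' zinj) /cond_ent.
  by congr (_ - _); apply: eq_entropy => w /=; rewrite ZZ'.
(* The mass of a cell: the coordinate [c] sums out by [n1], leaving the conditional law [m a]. *)
have sumA a (Q : pred B) :
    \sum_(i : A * B * C | (i.1.1 == a) && Q i.1.2) P (th i) =
    p a * \sum_(b | Q b) m a b.
  transitivity (\sum_(i : A * B | (i.1 == a) && Q i.2) \sum_c P (th (i, c))).
    by rewrite [RHS]pair_big /=; apply: eq_big => -[[i1 i2] c] //=; rewrite andbT.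
  transitivity (\sum_(i | i == a) \sum_(b | Q b) \sum_c P (th (i, b, c))).
    by rewrite [RHS]pair_big /=; apply: eq_big => -[].
  rewrite big_pred1_eq mulr_sumr; apply: eq_bigr => b _.
  rewrite -[RHS]mulr1 -n1 mulr_sumr; apply: eq_bigr => c _; exact: PE.
have pmfZ a : pmf_of P Z' a = p a.
  rewrite /pmf_of (reindex th) /=; last exact: onW_bij.
  transitivity (p a * \sum_(b | true) m a b); last by rewrite m1 mulr1.
  by rewrite -sumA; apply: eq_bigl => i; rewrite /Z' thK andbT.
have pmfYZ a v : pmf_of P (fun w => (Y w, Z' w)) (v, a)
    = p a * \sum_(b | y a b == v) m a b.
  rewrite /pmf_of (reindex th) /=; last exact: onW_bij.
  transitivity (\sum_(i : A * B * C | (i.1.1 == a) && (y a i.1.2 == v)) P (th i)).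
    apply: eq_bigl => -[[a' b] c]; rewrite /Z' thK YE xpair_eqE /= andbC.
    by case: eqP => // ->.
  exact: sumA.
rewrite /cond_ent /entropy.
have -> : \sum_(t : bool * A) xlog2x (pmf_of P (fun w => (Y w, Z' w)) t) =
    \sum_v \sum_a xlog2x (pmf_of P (fun w => (Y w, Z' w)) (v, a)).
  by rewrite pair_bigA /=; apply: eq_bigr => -[].
rewrite big_bool /= -big_split /= opprK addrC -sumrB; apply: eq_bigr => a _.
rewrite !pmfYZ pmfZ.
set s := \sum_(b | y a b == true) m a b.
have sE : \sum_(b | y a b) m a b = s by apply: eq_bigl => b; rewrite eqb_id.
have s'E : \sum_(b | y a b == false) m a b = 1 - s.
  rewrite -(m1 a) [X in X - _](bigID (fun b => y a b == true)) /= addrAC subrr add0r.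
  by apply: eq_bigl => b; case: (y a b).
have s0 : 0 <= s by apply: sumr_ge0.
have s'0 : 0 <= 1 - s by rewrite -s'E; apply: sumr_ge0.
(* Here [s] is the conditional probability of output 1. The product rule splits off [xlog2x (p a)]
   with total weight [s + (1 - s)], which cancels the term from the entropy of [Z']. *)
rewrite s'E sE !xlog2xM // /hb; ring.
Qed.
End Entropy.

(** * Conditional entropies of the first receiver's output *)

Section OutputEntropy.
Variable R : realType.
Implicit Types (x y p : R).

Lemma hbC p : hb (1 - p) = hb p.
Proof. by rewrite /hb subKr addrC. Qed.

Lemma ln2_gt0 : 0 < ln (2 : R).
Proof. by apply: ln_gt0; rewrite ltr1n. Qed.

Lemma hb0 : hb (0 : R) = 0.
Proof. by rewrite /hb subr0 xlog2x0 /xlog2x oner_eq0 ln1 mul0r mulr0 addr0 oppr0. Qed.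

Lemma hb_half : hb (2^-1 : R) = 1.
Proof.
have -> : hb (2^-1 : R) = - 2 * xlog2x 2^-1.
  by rewrite /hb (_ : 1 - 2^-1 = 2^-1 :> R); [ring | lra].
rewrite /xlog2x invr_eq0 pnatr_eq0 /= lnV ?posrE ?ltr0n //.
by field; rewrite gt_eqF ?ln2_gt0.
Qed.

Lemma bern_ge0 p b : 0 <= p <= 1 -> 0 <= bern p b.
Proof. by rewrite /bern => /andP[]; case: b; lra. Qed.

Lemma sum_pair (A B : finType) (F : A * B -> R) :
  \sum_t F t = \sum_a \sum_b F (a, b).
Proof. by rewrite pair_bigA; apply: eq_bigr => -[]. Qed.

(* [H(X_i | X_ic)] when [X_ic] has parameter [a / 2]: given [X_ic = 0], the
   input is [0] with probability [1 / (2 - a)]; given [X_ic = 1] it is determined. *)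
Definition Hpriv (a : R) : R := (1 - a / 2) * hb (2 - a)^-1.

(* [H(X_1 + X_2 | X_1c, X_2c)], split according to which common bits are set. *)
Definition Hxor (a b : R) : R :=
  a / 2 * Hpriv b + b / 2 * Hpriv a +
  (1 - a / 2) * (1 - b / 2) *
    hb ((2 - a)^-1 * (2 - b)^-1 + (1 - (2 - a)^-1) * (1 - (2 - b)^-1)).

Section Receiver1.
Variables pd pc d1 d2 : R.
Hypotheses (pd01 : 0 <= pd <= 1) (pc01 : 0 <= pc <= 1).
Hypotheses (d101 : 0 <= d1 <= 1) (d201 : 0 <= d2 <= 1).

Let P := Pjoint pd pc d1 d2.
Let M := (Hpriv d1 + Hpriv d2) / 2.
Let al1 (q : bool) := if q then d2 else d1.
Let al2 (q : bool) := if q then d1 else d2.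
Let pp (a : R) := 1 - (2 - a)^-1.

Let al101 q : 0 <= al1 q <= 1. Proof. by case: q. Qed.
Let al201 q : 0 <= al2 q <= 1. Proof. by case: q. Qed.

Lemma half_itv (a : R) : 0 <= a <= 1 -> 0 <= a / 2 <= 1.
Proof. by move=> /andP[]; lra. Qed.

Lemma priv_itv (a : R) : 0 <= a <= 1 -> 0 <= 1 - (2 - a)^-1 <= 1.
Proof.
move=> /andP[a0 a1]; have a2 : 0 < 2 - a by lra.
have : 0 <= (2 - a)^-1 by rewrite invr_ge0 ltW.
have : (2 - a)^-1 <= 1 by rewrite invf_le1 //; lra.
lra.
Qed.

Let unused (c : bool * bool) := bern pc c.1 * bern pd c.2.

Ltac split_pairs :=
  rewrite ?/cancel; intros;
  repeat match goal with t : ?T |- _ =>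
    lazymatch eval hnf in T with prod _ _ => destruct t end end.

Ltac nonneg := rewrite /= ?mulr_ge0 ?bern_ge0 ?half_itv ?priv_itv ?invr_ge0 ?ler0n //.

Ltac sum1 := rewrite !(sum_pair, big_bool) /=; ring.

Let two1 : 2 - d1 != 0.
Proof. by case/andP: d101 => *; rewrite gt_eqF //; lra. Qed.

Let two2 : 2 - d2 != 0.
Proof. by case/andP: d201 => *; rewrite gt_eqF //; lra. Qed.

Ltac same_hb := first
  [ congr hb; field; by rewrite ?two1 ?two2
  | rewrite -[LHS]hbC; congr hb; field; by rewrite ?two1 ?two2 ].

(** In each cell the output is deterministic, uniform, or has a tabulated bias; these match [hb0],
    [hb_half] and a direct comparison, each up to the symmetry [hbC]. *)
Ltac eval_hb q g11 g21 :=
  case: q g11 g21 => [] [] [];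
  repeat match goal with b : ?T |- _ =>
    lazymatch eval hnf in T with bool => destruct b end end;
  rewrite /= /al1 /al2 /=;
  first [same_hb | rewrite -[RHS]hb_half; same_hb | rewrite -[RHS]hb0; same_hb].

(** A single active gain exposes one input, whose residual entropy averages to [M] over the
    time-sharing bit; two active gains expose the sum of the inputs, hence [Hxor]. *)
Lemma cond_entY1_commons :
  cond_ent P vY1 (fun w => (vX1c w, vX2c w, vQ w, vGG1 w)) =
  (pd * (1 - pc) + (1 - pd) * pc) * M + pd * pc * Hxor d1 d2.
Proof.
pose th
    (t : (bool * bool * bool * (bool * bool)) * (bool * bool) * (bool * bool)) : Omega :=
  let: (x1c, x2c, q, (g11, g21), (x1p, x2p), (g12, g22)) := t in
  (q, x1c, x1p, x2c, x2p, g11, g12, g21, g22).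
have th_bij : bijective th.
  exists (fun w : Omega =>
    let: (q, x1c, x1p, x2c, x2p, g11, g12, g21, g22) := w in
    (x1c, x2c, q, (g11, g21), (x1p, x2p), (g12, g22))); by split_pairs.
pose y (a : bool * bool * bool * (bool * bool)) (b : bool * bool) :=
  let: (x1c, x2c, q, (g11, g21)) := a in let: (x1p, x2p) := b in
  (g11 && (x1c || x1p)) (+) (g21 && (x2c || x2p)).
pose p (a : bool * bool * bool * (bool * bool)) :=
  let: (x1c, x2c, q, (g11, g21)) := a in
  2^-1 * bern (al1 q / 2) x1c * bern (al2 q / 2) x2c * bern pd g11 *
    bern pc g21.
pose m (a : bool * bool * bool * (bool * bool)) (b : bool * bool) :=
  let: (x1c, x2c, q, (g11, g21)) := a in let: (x1p, x2p) := b in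
  bern (pp (al1 q)) x1p * bern (pp (al2 q)) x2p.
(* The table [v] gives the residual entropy of the output for each pattern of gains and common bits;
   a set common bit fixes its input. *)
pose v (a : bool * bool * bool * (bool * bool)) : R :=
  let: (x1c, x2c, q, (g11, g21)) := a in
  match g11, g21 with
  | true, true => match x1c, x2c with
    | true, true => 0
    | true, false => hb (2 - al2 q)^-1
    | false, true => hb (2 - al1 q)^-1
    | false, false => hb ((2 - d1)^-1 * (2 - d2)^-1 + (1 - (2 - d1)^-1) * (1 - (2 - d2)^-1))
    end
  | true, false => if x1c then 0 else hb (2 - al1 q)^-1
  | false, true => if x2c then 0 else hb (2 - al2 q)^-1
  | false, false => 0
  end.
rewrite (@cond_ent_fiber _ P _ _ _ th p m unused _ id y) //; try by split_pairs.
- transitivity (\sum_a p a * v a); last first.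
    by rewrite !(sum_pair, big_bool) /p /v /al1 /al2 /M /Hxor /Hpriv /=; field.
  apply: eq_bigr => -[[[x1c x2c] q] [g11 g21]] _; congr (_ * _).
  by rewrite big_mkcond !(sum_pair, big_bool) /= /m /v /pp; eval_hb q g11 g21.
- split_pairs; rewrite /P /th /p /m /unused /pp /al1 /al2 /=; ring.
- by split_pairs; nonneg.
- by split_pairs; nonneg.
- by split_pairs; rewrite /m; sum1.
- by rewrite /unused; sum1.
Qed.

(** The first input is now fully known, so only the second one, heard through an active cross gain,
    leaves uncertainty. *)
Lemma cond_entY1_commons_priv1 :
  cond_ent P vY1 (fun w => (vX1p w, (vX1c w, vX2c w, vQ w, vGG1 w))) =
  pc * M.
Proof.
pose th
    (t : (bool * (bool * bool * bool * (bool * bool))) * bool * (bool * bool)) : Omega :=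
  let: ((x1p, (x1c, x2c, q, (g11, g21))), x2p, (g12, g22)) := t in
  (q, x1c, x1p, x2c, x2p, g11, g12, g21, g22).
have th_bij : bijective th.
  exists (fun w : Omega =>
    let: (q, x1c, x1p, x2c, x2p, g11, g12, g21, g22) := w in
    ((x1p, (x1c, x2c, q, (g11, g21))), x2p, (g12, g22))); by split_pairs.
pose y (a : bool * (bool * bool * bool * (bool * bool))) (b : bool) :=
  let: (x1p, (x1c, x2c, q, (g11, g21))) := a in let: x2p := b in
  (g11 && (x1c || x1p)) (+) (g21 && (x2c || x2p)).
pose p (a : bool * (bool * bool * bool * (bool * bool))) :=
  let: (x1p, (x1c, x2c, q, (g11, g21))) := a in
  2^-1 * bern (al1 q / 2) x1c * bern (pp (al1 q)) x1p *
    bern (al2 q / 2) x2c * bern pd g11 * bern pc g21.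
pose m (a : bool * (bool * bool * bool * (bool * bool))) (b : bool) :=
  let: (x1p, (x1c, x2c, q, (g11, g21))) := a in let: x2p := b in
  bern (pp (al2 q)) x2p.
pose v (a : bool * (bool * bool * bool * (bool * bool))) : R :=
  let: (x1p, (x1c, x2c, q, (g11, g21))) := a in
  if g21 then (if x2c then 0 else hb (2 - al2 q)^-1) else 0.
rewrite (@cond_ent_fiber _ P _ _ _ th p m unused _ id y) //; try by split_pairs.
- transitivity (\sum_a p a * v a); last first.
    by rewrite !(sum_pair, big_bool) /p /v /al1 /al2 /M /Hxor /Hpriv /=; field.
  apply: eq_bigr => -[x1p [[[x1c x2c] q] [g11 g21]]] _; congr (_ * _).
  by rewrite big_mkcond !(sum_pair, big_bool) /= /m /v /pp; eval_hb q g11 g21.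
- split_pairs; rewrite /P /th /p /m /unused /pp /al1 /al2 /=; ring.
- by split_pairs; nonneg.
- by split_pairs; nonneg.
- by split_pairs; rewrite /m; sum1.
- by rewrite /unused; sum1.
Qed.

(** The inputs are independent fair bits, so the output is a fair bit as soon as one gain is
    active. *)
Lemma cond_entY1 :
  cond_ent P vY1 (fun w => (vQ w, vGG1 w)) =
  pd + pc - pd * pc.
Proof.
pose th
    (t : (bool * (bool * bool)) * (bool * bool * bool * bool) * (bool * bool)) : Omega :=
  let: ((q, (g11, g21)), (x1c, x1p, x2c, x2p), (g12, g22)) := t in
  (q, x1c, x1p, x2c, x2p, g11, g12, g21, g22).
have th_bij : bijective th.
  exists (fun w : Omega =>
    let: (q, x1c, x1p, x2c, x2p, g11, g12, g21, g22) := w in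
    ((q, (g11, g21)), (x1c, x1p, x2c, x2p), (g12, g22))); by split_pairs.
pose y (a : bool * (bool * bool)) (b : bool * bool * bool * bool) :=
  let: (q, (g11, g21)) := a in let: (x1c, x1p, x2c, x2p) := b in
  (g11 && (x1c || x1p)) (+) (g21 && (x2c || x2p)).
pose p (a : bool * (bool * bool)) := let: (q, (g11, g21)) := a in
  2^-1 * bern pd g11 * bern pc g21.
pose m (a : bool * (bool * bool)) (b : bool * bool * bool * bool) :=
  let: (q, (g11, g21)) := a in let: (x1c, x1p, x2c, x2p) := b in
  bern (al1 q / 2) x1c * bern (pp (al1 q)) x1p * bern (al2 q / 2) x2c *
    bern (pp (al2 q)) x2p.
pose v (a : bool * (bool * bool)) : R := let: (q, (g11, g21)) := a in
  if g11 || g21 then 1 else 0.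
rewrite (@cond_ent_fiber _ P _ _ _ th p m unused _ id y) //; try by split_pairs.
- transitivity (\sum_a p a * v a); last first.
    by rewrite !(sum_pair, big_bool) /p /v /al1 /al2 /M /Hxor /Hpriv /=; field.
  apply: eq_bigr => -[q [g11 g21]] _; congr (_ * _).
  by rewrite big_mkcond !(sum_pair, big_bool) /= /m /v /pp; eval_hb q g11 g21.
- split_pairs; rewrite /P /th /p /m /unused /pp /al1 /al2 /=; ring.
- by split_pairs; nonneg.
- by split_pairs; nonneg.
- by split_pairs; rewrite /m; sum1.
- by rewrite /unused; sum1.
Qed.

(** An active direct gain adds the fair bit [X1] and makes the output uniform; otherwise only the
    private part of [X2] is left, over the cross link. *)
Lemma cond_entY1_common2 :
  cond_ent P vY1 (fun w => (vX2c w, vQ w, vGG1 w)) =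
  pd + (1 - pd) * pc * M.
Proof.
pose th
    (t : (bool * bool * (bool * bool)) * (bool * bool * bool) * (bool * bool)) : Omega :=
  let: ((x2c, q, (g11, g21)), (x1c, x1p, x2p), (g12, g22)) := t in
  (q, x1c, x1p, x2c, x2p, g11, g12, g21, g22).
have th_bij : bijective th.
  exists (fun w : Omega =>
    let: (q, x1c, x1p, x2c, x2p, g11, g12, g21, g22) := w in
    ((x2c, q, (g11, g21)), (x1c, x1p, x2p), (g12, g22))); by split_pairs.
pose y (a : bool * bool * (bool * bool)) (b : bool * bool * bool) :=
  let: (x2c, q, (g11, g21)) := a in let: (x1c, x1p, x2p) := b in
  (g11 && (x1c || x1p)) (+) (g21 && (x2c || x2p)).
pose p (a : bool * bool * (bool * bool)) := let: (x2c, q, (g11, g21)) := a in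
  2^-1 * bern (al2 q / 2) x2c * bern pd g11 * bern pc g21.
pose m (a : bool * bool * (bool * bool)) (b : bool * bool * bool) :=
  let: (x2c, q, (g11, g21)) := a in let: (x1c, x1p, x2p) := b in
  bern (al1 q / 2) x1c * bern (pp (al1 q)) x1p * bern (pp (al2 q)) x2p.
pose v (a : bool * bool * (bool * bool)) : R :=
  let: (x2c, q, (g11, g21)) := a in
  if g11 then 1 else if g21 then (if x2c then 0 else hb (2 - al2 q)^-1) else 0.
rewrite (@cond_ent_fiber _ P _ _ _ th p m unused _ id y) //; try by split_pairs.
- transitivity (\sum_a p a * v a); last first.
    by rewrite !(sum_pair, big_bool) /p /v /al1 /al2 /M /Hxor /Hpriv /=; field.
  apply: eq_bigr => -[[x2c q] [g11 g21]] _; congr (_ * _).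
  by rewrite big_mkcond !(sum_pair, big_bool) /= /m /v /pp; eval_hb q g11 g21.
- split_pairs; rewrite /P /th /p /m /unused /pp /al1 /al2 /=; ring.
- by split_pairs; nonneg.
- by split_pairs; nonneg.
- by split_pairs; rewrite /m; sum1.
- by rewrite /unused; sum1.
Qed.

Lemma cond_entY1_common1 :
  cond_ent P vY1 (fun w => (vX1c w, vQ w, vGG1 w)) =
  pc + pd * (1 - pc) * M.
Proof.
pose th
    (t : (bool * bool * (bool * bool)) * (bool * bool * bool) * (bool * bool)) : Omega :=
  let: ((x1c, q, (g11, g21)), (x2c, x1p, x2p), (g12, g22)) := t in
  (q, x1c, x1p, x2c, x2p, g11, g12, g21, g22).
have th_bij : bijective th.
  exists (fun w : Omega =>
    let: (q, x1c, x1p, x2c, x2p, g11, g12, g21, g22) := w in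
    ((x1c, q, (g11, g21)), (x2c, x1p, x2p), (g12, g22))); by split_pairs.
pose y (a : bool * bool * (bool * bool)) (b : bool * bool * bool) :=
  let: (x1c, q, (g11, g21)) := a in let: (x2c, x1p, x2p) := b in
  (g11 && (x1c || x1p)) (+) (g21 && (x2c || x2p)).
pose p (a : bool * bool * (bool * bool)) := let: (x1c, q, (g11, g21)) := a in
  2^-1 * bern (al1 q / 2) x1c * bern pd g11 * bern pc g21.
pose m (a : bool * bool * (bool * bool)) (b : bool * bool * bool) :=
  let: (x1c, q, (g11, g21)) := a in let: (x2c, x1p, x2p) := b in
  bern (pp (al1 q)) x1p * bern (al2 q / 2) x2c * bern (pp (al2 q)) x2p.
pose v (a : bool * bool * (bool * bool)) : R :=
  let: (x1c, q, (g11, g21)) := a in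
  if g21 then 1 else if g11 then (if x1c then 0 else hb (2 - al1 q)^-1) else 0.
rewrite (@cond_ent_fiber _ P _ _ _ th p m unused _ id y) //; try by split_pairs.
- transitivity (\sum_a p a * v a); last first.
    by rewrite !(sum_pair, big_bool) /p /v /al1 /al2 /M /Hxor /Hpriv /=; field.
  apply: eq_bigr => -[[x1c q] [g11 g21]] _; congr (_ * _).
  by rewrite big_mkcond !(sum_pair, big_bool) /= /m /v /pp; eval_hb q g11 g21.
- split_pairs; rewrite /P /th /p /m /unused /pp /al1 /al2 /=; ring.
- by split_pairs; nonneg.
- by split_pairs; nonneg.
- by split_pairs; rewrite /m; sum1.
- by rewrite /unused; sum1.
Qed.

End Receiver1.
End OutputEntropy.

(** * Closed forms of the mutual informations in the rate constraints *)

Section MutualInformation.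
Variable R : realType.
Variables pd pc : R.
Hypotheses (pd01 : 0 <= pd <= 1) (pc01 : 0 <= pc <= 1).

Definition Mpriv (d1 d2 : R) : R := (Hpriv d1 + Hpriv d2) / 2.

Definition rate_priv (d1 d2 : R) : R :=
  pd * ((1 - 2 * pc) * Mpriv d1 d2 + pc * Hxor d1 d2).

Definition rate_both (d1 d2 : R) : R :=
  (pd * (1 - pc) + (1 - pd) * pc) * (1 - Mpriv d1 d2) +
  pd * pc * (1 - Hxor d1 d2).

(** [rate_direct] bounds a common rate at its own receiver, [rate_cross] at the other one. *)
Definition rate_direct (d1 d2 : R) : R :=
  pd * (1 - pc) * (1 - Mpriv d1 d2) + pd * pc * (1 - Hxor d1 d2).

Definition rate_cross (d1 d2 : R) : R :=
  (1 - pd) * pc * (1 - Mpriv d1 d2) + pd * pc * (1 - Hxor d1 d2).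

Lemma HxorC (d1 d2 : R) : Hxor d1 d2 = Hxor d2 d1.
Proof.
rewrite /Hxor mulrC [(1 - _^-1) * _]mulrC.
rewrite [(2 - d2)^-1 * _]mulrC [(1 - (2 - d2)^-1) * _]mulrC.
ring.
Qed.

(** Relabels the users but keeps the time-sharing bit, so the law with parameters [d1], [d2] becomes
    the one with [d2], [d1]. *)
Definition swap_users (w : Omega) : Omega :=
  let: (q, x1c, x1p, x2c, x2p, g11, g12, g21, g22) := w in
  (q, x2c, x2p, x1c, x1p, g22, g21, g12, g11).

Lemma swap_usersK : involutive swap_users.
Proof. by move=> [[[[[[[[? ?] ?] ?] ?] ?] ?] ?] ?]. Qed.

Lemma entropy_swap_users (d1 d2 : R) (T : finType) (f : Omega -> T) :
  entropy (Pjoint pd pc d1 d2) f =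
  entropy (Pjoint pd pc d2 d1) (fun w => f (swap_users w)).
Proof.
congr (- _); apply: eq_bigr => t _; congr xlog2x.
rewrite /pmf_of (reindex_inj (inv_inj swap_usersK)); apply: eq_bigr.
by move=> [[[[[[[[q ?] ?] ?] ?] ?] ?] ?] ?] _ /=; case: q; ring.
Qed.

Lemma cmi_swap_users (d1 d2 : R) (A B C : finType)
    (f : Omega -> A) (g : Omega -> B) (h : Omega -> C) :
  cmi (Pjoint pd pc d1 d2) f g h =
  cmi (Pjoint pd pc d2 d1) (fun w => f (swap_users w))
    (fun w => g (swap_users w)) (fun w => h (swap_users w)).
Proof. by rewrite /cmi !(entropy_swap_users d1 d2). Qed.

Lemma eq_cmi (P : Omega -> R) (A B C : finType) (f f' : Omega -> A)
    (g g' : Omega -> B) (h h' : Omega -> C) :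
  f =1 f' -> g =1 g' -> h =1 h' -> cmi P f g h = cmi P f' g' h'.
Proof.
move=> ff' gg' hh'; rewrite /cmi.
by congr (_ + _ - _ - _); apply: eq_entropy => w; rewrite ?ff' ?gg' ?hh'.
Qed.

(** Absorbs the permutations of common bits that [swap_users] produces in the constraints of
    receiver 2. *)
Lemma cmi_recode (P : Omega -> R) (A A' B C C' : finType) (e : A -> A')
    (k : C -> C') (f : Omega -> A) (g : Omega -> B) (h : Omega -> C) :
  injective e -> injective k ->
  cmi P (fun w => e (f w)) g (fun w => k (h w)) = cmi P f g h.
Proof.
move=> einj kinj; rewrite !cmiE cond_ent_recode //; congr (_ - _).
pose ek (t : A * C) := (e t.1, k t.2).
have ek_inj : injective ek by move=> [? ?] [? ?] [/einj -> /kinj ->].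
exact: (cond_ent_recode P g (fun w => (f w, h w)) ek_inj).
Qed.

Section Receivers.
Variables d1 d2 : R.
Hypotheses (d101 : 0 <= d1 <= 1) (d201 : 0 <= d2 <= 1).
Let P := Pjoint pd pc d1 d2.

Lemma cmi_private1 :
  cmi P vX1p vY1 (fun w => (vX1c w, vX2c w, vQ w, vGG1 w)) = rate_priv d1 d2.
Proof.
rewrite cmiE cond_entY1_commons // cond_entY1_commons_priv1 //.
by rewrite /rate_priv /Mpriv; ring.
Qed.

Lemma cmi_both1 :
  cmi P (fun w => (vX1c w, vX2c w)) vY1 (fun w => (vQ w, vGG1 w)) =
  rate_both d1 d2.
Proof.
(* [cmiE] conditions on a nested pair; [k] regroups the flat tuple for which the entropy was
   computed. *)
pose k (t : bool * bool * bool * (bool * bool)) :=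
  let: (x1c, x2c, q, g) := t in ((x1c, x2c), (q, g)).
have k_inj : injective k by move=> [[[? ?] ?] ?] [[[? ?] ?] ?] [-> -> -> ->].
rewrite cmiE cond_entY1 //.
rewrite (cond_ent_recode P vY1 (fun w => (vX1c w, vX2c w, vQ w, vGG1 w)) k_inj).
by rewrite cond_entY1_commons // /rate_both /Mpriv; ring.
Qed.

Lemma cmi_direct1 :
  cmi P vX1c vY1 (fun w => (vX2c w, vQ w, vGG1 w)) = rate_direct d1 d2.
Proof.
pose k (t : bool * bool * bool * (bool * bool)) :=
  let: (x1c, x2c, q, g) := t in (x1c, (x2c, q, g)).
have k_inj : injective k by move=> [[[? ?] ?] ?] [[[? ?] ?] ?] [-> -> -> ->].
rewrite cmiE cond_entY1_common2 //.
rewrite (cond_ent_recode P vY1 (fun w => (vX1c w, vX2c w, vQ w, vGG1 w)) k_inj).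
by rewrite cond_entY1_commons // /rate_direct /Mpriv; ring.
Qed.

Lemma cmi_cross1 :
  cmi P vX2c vY1 (fun w => (vX1c w, vQ w, vGG1 w)) = rate_cross d1 d2.
Proof.
pose k (t : bool * bool * bool * (bool * bool)) :=
  let: (x1c, x2c, q, g) := t in (x2c, (x1c, q, g)).
have k_inj : injective k by move=> [[[? ?] ?] ?] [[[? ?] ?] ?] [-> -> -> ->].
rewrite cmiE cond_entY1_common1 //.
rewrite (cond_ent_recode P vY1 (fun w => (vX1c w, vX2c w, vQ w, vGG1 w)) k_inj).
by rewrite cond_entY1_commons // /rate_cross /Mpriv; ring.
Qed.
End Receivers.

(** * The second receiver, by symmetry *)

Section Receiver2.
Variables d1 d2 : R.
Hypotheses (d101 : 0 <= d1 <= 1) (d201 : 0 <= d2 <= 1).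
Let P := Pjoint pd pc d1 d2.


Let YE : forall w, vY2 (swap_users w) = vY1 w.
Proof. by move=> [[[[[[[[? ?] ?] ?] ?] ?] ?] ?] ?]. Qed.

Let split_w (T : Type) (f g : Omega -> T) :
  (forall q x1c x1p x2c x2p g11 g12 g21 g22,
     let w : Omega := (q, x1c, x1p, x2c, x2p, g11, g12, g21, g22) in
     f w = g w) -> f =1 g.
Proof. by move=> fg [[[[[[[[? ?] ?] ?] ?] ?] ?] ?] ?]. Qed.

(** Exchanging the users leads back to receiver 1 with [d1] and [d2] exchanged, and the closed form
    is symmetric in them. *)
Lemma cmi_private2 :
  cmi P vX2p vY2 (fun w => (vX1c w, vX2c w, vQ w, vGG2 w)) = rate_priv d1 d2.
Proof.
pose k (t : bool * bool * bool * (bool * bool)) :=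
  let: (x1c, x2c, q, g) := t in (x2c, x1c, q, g).
have k_inj : injective k by move=> [[[? ?] ?] ?] [[[? ?] ?] ?] [-> -> -> ->].
have rE : rate_priv d1 d2 = rate_priv d2 d1.
  by rewrite /rate_priv /Mpriv HxorC; ring.
rewrite cmi_swap_users rE -cmi_private1 // -(cmi_recode _ _ _ _ (@inj_id _) k_inj).
by apply: eq_cmi; exact: split_w.
Qed.

Lemma cmi_both2 :
  cmi P (fun w => (vX1c w, vX2c w)) vY2 (fun w => (vQ w, vGG2 w)) =
  rate_both d1 d2.
Proof.
pose k (t : bool * bool) := (t.2, t.1).
have k_inj : injective k by move=> [? ?] [? ?] [-> ->].
have rE : rate_both d1 d2 = rate_both d2 d1.
  by rewrite /rate_both /Mpriv HxorC; ring.
rewrite cmi_swap_users rE -cmi_both1 // -(cmi_recode _ _ _ _ k_inj (@inj_id _)).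
by apply: eq_cmi; exact: split_w.
Qed.

Lemma cmi_direct2 :
  cmi P vX2c vY2 (fun w => (vX1c w, vQ w, vGG2 w)) = rate_direct d1 d2.
Proof.
have rE : rate_direct d1 d2 = rate_direct d2 d1.
  by rewrite /rate_direct /Mpriv HxorC; ring.
rewrite cmi_swap_users rE -cmi_direct1 //.
by apply: eq_cmi; exact: split_w.
Qed.

Lemma cmi_cross2 :
  cmi P vX1c vY2 (fun w => (vX2c w, vQ w, vGG2 w)) = rate_cross d1 d2.
Proof.
have rE : rate_cross d1 d2 = rate_cross d2 d1.
  by rewrite /rate_cross /Mpriv HxorC; ring.
rewrite cmi_swap_users rE -cmi_cross1 //.
by apply: eq_cmi; exact: split_w.
Qed.
End Receiver2.
End MutualInformation.

(** * Inequalities and continuity for the entropy functions *)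

Section Analysis.
Variable R : realType.
Implicit Types (x y p : R).

Lemma ln_le_subr1 x : 0 < x -> ln x <= x - 1.
Proof.
by move=> x0; have := @le_ln1Dx R (x - 1);
  rewrite addrCA subrr addr0; apply; lra. Qed.

Lemma hb_ge0 p : 0 <= p <= 1 -> 0 <= hb p.
Proof.
have neg (q : R) : 0 <= q <= 1 -> xlog2x q <= 0.
  case/andP=> q0 q1; rewrite /xlog2x; case: eqP => // _.
  by rewrite mulr_ge0_le0 // mulr_le0_ge0 ?ln_le0 // invr_ge0 ltW ?ln2_gt0.
move=> /andP[p0 p1]; have := neg p; have := neg (1 - p).
rewrite /hb; move=> /(_ ltac:(lra)) + /(_ ltac:(lra)); lra.
Qed.

(* Gibbs: [ln (1 / (2 x)) <= 1 / (2 x) - 1]. *)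
Lemma xlog2x_ge x : 0 <= x -> x - 2^-1 - x * ln 2 <= xlog2x x * ln 2.
Proof.
rewrite /xlog2x le_eqVlt => /predU1P[<-|x0]; first by rewrite eqxx; lra.
rewrite gt_eqF // -mulrA divfK ?gt_eqF ?ln2_gt0 //.
have := @ln_le_subr1 (2 * x)^-1; rewrite invr_gt0 lnV ?posrE ?lnM ?posrE; try lra.
move=> /(_ ltac:(lra)); rewrite -(ler_pM2l x0) invfM mulrBr mulrCA divff ?gt_eqF //.
lra.
Qed.

Lemma hb_le1 p : 0 <= p <= 1 -> hb p <= 1.
Proof.
case/andP=> p0 p1; rewrite -(ler_pM2r (ln2_gt0 R)) /hb.
have := xlog2x_ge p0; have := @xlog2x_ge (1 - p) ltac:(lra); lra.
Qed.

(** Since the logarithm increases, each term grows when its logarithm is taken at [x + y]: merging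
    two outcomes cannot raise entropy. *)
Lemma xlog2x_superadd x y : 0 <= x -> 0 <= y ->
  xlog2x x + xlog2x y <= xlog2x (x + y).
Proof.
rewrite le_eqVlt => /predU1P[<-|x0]; first by rewrite xlog2x0 !add0r.
rewrite le_eqVlt => /predU1P[<-|y0]; first by rewrite xlog2x0 !addr0.
rewrite /xlog2x !gt_eqF ?addr_gt0 // mulrDl.
by apply: lerD; apply: ler_wpM2l; rewrite ?ltW // ltr_pM2r ?invr_gt0 ?ln2_gt0 //
  ltr_ln ?posrE; lra.
Qed.

(** The exclusive or of two independent bits merges the four outcomes of the pair into two, and the
    pair has entropy [hb p + hb q]. *)
Lemma hb_conv_le p (q : R) : 0 <= p <= 1 -> 0 <= q <= 1 ->
  hb (p * q + (1 - p) * (1 - q)) <= hb p + hb q.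
Proof.
case/andP=> p0 p1 /andP[q0 q1].
have p'0 : 0 <= 1 - p by lra.
have q'0 : 0 <= 1 - q by lra.
have := xlog2x_superadd (mulr_ge0 p0 q0) (mulr_ge0 p'0 q'0).
have := xlog2x_superadd (mulr_ge0 p0 q'0) (mulr_ge0 p'0 q0).
rewrite !xlog2xM // /hb.
rewrite (_ : p * (1 - q) + (1 - p) * q = 1 - (p * q + (1 - p) * (1 - q)));
  last by ring.
lra.
Qed.

Lemma inv2B_itv (a : R) : 0 <= a <= 1 -> 0 <= (2 - a)^-1 <= 1.
Proof. by move=> /priv_itv/andP[]; lra. Qed.

Lemma Hpriv_ge0 (a : R) : 0 <= a <= 1 -> 0 <= Hpriv a.
Proof.
move=> a01; rewrite mulr_ge0 ?hb_ge0 ?inv2B_itv //; case/andP: a01; lra.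
Qed.

Lemma Hpriv_le1 (a : R) : 0 <= a <= 1 -> Hpriv a <= 1.
Proof.
move=> a01; have := hb_le1 (inv2B_itv a01); have := hb_ge0 (inv2B_itv a01).
case/andP: a01 => *; rewrite /Hpriv; nra.
Qed.

(** Only the cell with both common bits zero needs [hb_conv_le]; the weights then recombine exactly
    to the right-hand side. *)
Lemma Hxor_le (a b : R) : 0 <= a <= 1 -> 0 <= b <= 1 ->
  Hxor a b <= Hpriv a + Hpriv b.
Proof.
move=> a01 b01; have /andP[a0 a1] := a01; have /andP[b0 b1] := b01.
have := hb_conv_le (inv2B_itv a01) (inv2B_itv b01).
have ab0 : 0 <= (1 - a / 2) * (1 - b / 2) by rewrite mulr_ge0 //; lra.
move=> /(ler_wpM2l ab0).
rewrite /Hxor /Hpriv; lra.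
Qed.

(** The substitution [a = 1 - x] removes the inverses and gives a form whose continuity for [x > 0]
    is immediate. *)
Lemma HprivE (x : R) : 0 < x <= 1 ->
  Hpriv (1 - x) = ((1 + x) * ln (1 + x) - x * ln x) / (2 * ln 2).
Proof.
case/andP=> x0 x1; have x1_0 : 0 < 1 + x by lra.
rewrite /Hpriv /hb (_ : 2 - (1 - x) = 1 + x); last by ring.
rewrite (_ : 1 - (1 + x)^-1 = x / (1 + x)); last by field; rewrite gt_eqF.
rewrite /xlog2x !gt_eqF ?divr_gt0 ?invr_gt0 //= lnV ?ln_div ?posrE //.
by field; rewrite !gt_eqF ?ln2_gt0.
Qed.

Lemma Hpriv0 : Hpriv (0 : R) = 1.
Proof. by rewrite /Hpriv subr0 hb_half; lra. Qed.

Lemma Hpriv1 : Hpriv (1 : R) = 0.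
Proof.
rewrite /Hpriv (_ : (2 - 1)^-1 = 1 - 0 :> R);
  last by rewrite (_ : 2 - 1 = 1 :> R) ?invr1; lra.
by rewrite hbC hb0 mulr0.
Qed.

Lemma Hxor0 : Hxor (0 : R) 0 = 1.
Proof.
rewrite /Hxor !subr0 (_ : 2^-1 * 2^-1 + _ = 2^-1 :> R); last by lra.
by rewrite hb_half; lra.
Qed.

(** At parameter one the private bit is constantly zero, so the first input is determined by its
    common bit. As [Hpriv 1 = 0], [Hxor_le] is tight here. *)
Lemma Hxor1 (a : R) : Hxor 1 a = Hpriv a.
Proof.
rewrite /Hxor Hpriv1 (_ : 2 - 1 = 1 :> R) ?invr1; last by lra.
rewrite (_ : 1 * _ + _ = (2 - a)^-1); last by ring.
rewrite /Hpriv; lra.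
Qed.

Lemma Hpriv_surj (c : R) : 0 < c <= 1 -> exists2 a : R, 0 <= a <= 1 & Hpriv a = c.
Proof.
case/andP=> c0 c1; have l2 := @ln2_gt0 R.
pose f x := ((1 + x) * ln (1 + x) - x * ln x) / (2 * ln 2).
(* The left endpoint [y ^+ 2] stays away from the singularity of [ln] at zero. Taking a square makes
   [- y ^+ 2 * ln (y ^+ 2)] at most linear in [y], and this [y] satisfies [c * (2 * ln 2) = 4 * y],
   enough to get [f (y ^+ 2) <= c]. *)
pose y := c * ln 2 / 2.
have l2_1 : ln 2 <= 1 :> R by have := @ln_le_subr1 2; lra.
have y0 : 0 < y by rewrite !mulr_gt0 ?invr_gt0.
have y1 : y <= 1 by rewrite /y; nra.
have y2_0 : 0 < y ^+ 2 by rewrite exprn_gt0.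
have y2_1 : y ^+ 2 <= 1 by rewrite expr_le1 // ltW.
have fy : f (y ^+ 2) <= c.
  rewrite /f ler_pdivrMr ?mulr_gt0 //.
  have h1 : ln (1 + y ^+ 2) <= y ^+ 2 by apply: le_ln1Dx; lra.
  have h2 : - ln y <= y^-1 - 1.
    by rewrite -lnV ?posrE //; apply: ln_le_subr1; rewrite invr_gt0.
  have h3 : - (y ^+ 2 * ln (y ^+ 2)) <= 2 * (y - y ^+ 2).
    rewrite lnXn // (_ : y - y ^+ 2 = y ^+ 2 * (y^-1 - 1));
  last by field; rewrite gt_eqF.
    have := ler_wpM2l (ltW y2_0) h2; lra.
  have -> : c * (2 * ln 2) = 4 * y by rewrite /y; lra.
  have h4 : (1 + y ^+ 2) * ln (1 + y ^+ 2) <= (1 + y ^+ 2) * y ^+ 2.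
    by apply: ler_wpM2l => //; lra.
  have h5 : y ^+ 2 <= y by rewrite expr2; nra.
  have h6 : (1 + y ^+ 2) * y ^+ 2 <= 2 * y ^+ 2 by nra.
  lra.
have f1 : f 1 = 1 by rewrite /f ln1 mulr0 subr0; field; rewrite gt_eqF.
have fcont_at (x : R) : 0 < x -> {for x, continuous f}%classic.
  move=> xp; have x1p : 0 < 1 + x by lra.
  have cid : {for x, continuous (fun z : R => 1 + z)}%classic.
    by apply: cvgD; [exact: cvg_cst | exact: cvg_id].
  have cln1 : {for x, continuous (fun z : R => ln (1 + z))}%classic.
    exact: (continuous_comp cid (continuous_ln x1p)).
  apply: cvgM; last exact: cvg_cst.
  have cln := continuous_ln xp.
  by apply: cvgB; [exact: cvgM cid cln1 | exact: cvgM cvg_id cln].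
have fcont : {within `[y ^+ 2, 1], continuous f}%classic.
  apply: continuous_in_subspaceT => x; rewrite inE /= in_itv /= => /andP[x0 x1].
  by apply: fcont_at; apply: lt_le_trans x0.
have [|x] := IVT y2_1 fcont (v := c).
  by rewrite f1 ge_min fy le_max c1 orbT.
rewrite in_itv /= => /andP[x0 x1] fx.
exists (1 - x); first by apply/andP; split; lra.
by rewrite HprivE //; apply/andP; split; lra.
Qed.
End Analysis.

(** * Bounds on the sum rate and optimal rate tuples *)

Section SumRate.
Variable R : realType.
Variables pd pc : R.
Hypotheses (pc0 : 0 <= pc) (pcd : pc <= pd) (pd1 : pd <= 1).

Let pd01 : 0 <= pd <= 1.
Proof. by rewrite (le_trans pc0 pcd) pd1. Qed.
Let pc01 : 0 <= pc <= 1.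
Proof. by rewrite pc0 (le_trans pcd pd1). Qed.

Lemma HK_feasibleP (d1 d2 r1c r1p r2c r2p : R) :
  0 <= d1 <= 1 -> 0 <= d2 <= 1 ->
  HK_feasible pd pc d1 d2 r1c r1p r2c r2p <->
  [/\ 0 <= r1c, 0 <= r1p, 0 <= r2c & 0 <= r2p] /\
  [/\ r1p <= rate_priv pd pc d1 d2, r2p <= rate_priv pd pc d1 d2,
      r1c + r2c <= rate_both pd pc d1 d2 &
      [/\ r1c <= rate_direct pd pc d1 d2, r1c <= rate_cross pd pc d1 d2,
          r2c <= rate_direct pd pc d1 d2 & r2c <= rate_cross pd pc d1 d2]].
Proof.
move=> d101 d201; rewrite /HK_feasible cmi_private1 // cmi_private2 //.
rewrite cmi_both1 // cmi_both2 // cmi_direct1 // cmi_direct2 //.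
rewrite cmi_cross1 // cmi_cross2 //.
split=> [[? [? [? [? [? [? [? [? ?]]]]]]]]|[? [? ? ? [? ? ? ?]]]].
  by split=> //; split=> //; split.
by do 8?[split=> //].
Qed.

Lemma Mpriv_itv (d1 d2 : R) : 0 <= d1 <= 1 -> 0 <= d2 <= 1 ->
  0 <= Mpriv d1 d2 <= 1.
Proof.
move=> d101 d201; rewrite /Mpriv.
have := Hpriv_ge0 d101; have := Hpriv_ge0 d201.
have := Hpriv_le1 d101; have := Hpriv_le1 d201.
by move=> *; apply/andP; split; lra.
Qed.

Lemma feasible_sum_le (d1 d2 r1c r1p r2c r2p : R) :
  0 <= d1 <= 1 -> 0 <= d2 <= 1 ->
  HK_feasible pd pc d1 d2 r1c r1p r2c r2p ->
  r1c + r1p + r2c + r2p <= 2 * pc + 2 * (pd - pc - pd * pc) * Mpriv d1 d2 /\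
  r1c + r1p + r2c + r2p <= pd + pc - pd * pc + (pd - pc) * Mpriv d1 d2.
Proof.
have [pc0' pcd' pd1'] : [/\ 0 <= pc, pc <= pd & pd <= 1] by split.
move=> d101 d201 /(HK_feasibleP _ _ _ _ d101 d201) [_ [h1 h2 h3 [_ h4 _ h5]]].
move: h1 h2 h3 h4 h5; rewrite /rate_priv /rate_both /rate_cross => h1 h2 h3 h4 h5.
(* In twice [rate_priv] plus twice [rate_cross] the [Hxor] terms cancel. With [rate_both] instead,
   [Hxor] survives with coefficient [pd * pc] and has to be bounded by [SM]. *)
split; first lra.
have SM : Hxor d1 d2 <= 2 * Mpriv d1 d2.
  by have := Hxor_le d101 d201; rewrite /Mpriv; lra.
have : pd * pc * Hxor d1 d2 <= pd * pc * (2 * Mpriv d1 d2).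
  by apply: ler_wpM2l => //; rewrite mulr_ge0 //; lra.
lra.
Qed.

Lemma Rsum_le (d1 d2 V : R) : 0 <= V ->
  (forall r1c r1p r2c r2p, HK_feasible pd pc d1 d2 r1c r1p r2c r2p ->
     r1c + r1p + r2c + r2p <= V) ->
  Rsum pd pc d1 d2 <= V.
Proof.
move=> V0 ubV; rewrite /Rsum; set S := (X in sup X).
(* The supremum of the empty set is 0, which [0 <= V] covers. *)
have [->|S0] := eqVneq S set0; first by rewrite sup0.
apply: ge_sup; first exact/set0P.
by move=> _ [r1c [r1p [r2c [r2p [/ubV ? ->]]]]].
Qed.

Lemma Rsum_ge (d1 d2 r1c r1p r2c r2p : R) : 0 <= d1 <= 1 -> 0 <= d2 <= 1 ->
  HK_feasible pd pc d1 d2 r1c r1p r2c r2p ->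
  r1c + r1p + r2c + r2p <= Rsum pd pc d1 d2.
Proof.
move=> d101 d201 feas; apply: ub_le_sup; last by exists r1c, r1p, r2c, r2p.
(* A supremum dominates its members only for a bounded set; the second bound of [feasible_sum_le]
   supplies an upper bound. *)
exists (pd + pc - pd * pc + (pd - pc) * Mpriv d1 d2).
move=> _ [s1c [s1p [s2c [s2p [sf ->]]]]].
by have [] := feasible_sum_le d101 d201 sf.
Qed.

Lemma pc_gt : pd / (1 + pd) < pc -> pd < pc * (1 + pd).
Proof. by rewrite ltr_pdivrMr // ltr_wpDr // (le_trans pc0 pcd). Qed.

Lemma Cstar_mul : pd / (1 + pd) < pc ->
  Cstar pd pc * (pd * pc - (pd - pc) / 2) = pd * pc - (pd - pc).
Proof.
have [pc0' pcd' pd1'] : [/\ 0 <= pc, pc <= pd & pd <= 1] by split.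
by move=> /pc_gt h; rewrite /Cstar divfK // gt_eqF //; lra.
Qed.

(** Above the threshold the numerator is positive, and the denominator exceeds it by
    [(pd - pc) / 2]. *)
Lemma Cstar_itv : pd / (1 + pd) < pc -> 0 < Cstar pd pc <= 1.
Proof.
have [pc0' pcd' pd1'] : [/\ 0 <= pc, pc <= pd & pd <= 1] by split.
move=> /pc_gt h; have den0 : 0 < pd * pc - (pd - pc) / 2 by lra.
rewrite /Cstar; apply/andP; split; first by apply: divr_gt0; lra.
by rewrite ler_pdivrMr //; lra.
Qed.

(* [M = Cstar / 2] is where the two bounds of [feasible_sum_le] cross. *)
Lemma min_bounds_le (M s : R) : pd / (1 + pd) < pc ->
  s <= 2 * pc + 2 * (pd - pc - pd * pc) * M ->
  s <= pd + pc - pd * pc + (pd - pc) * M ->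
  s <= pd + pc - pd * pc + (pd - pc) / 2 * Cstar pd pc.
Proof.
have [pc0' pcd' pd1'] : [/\ 0 <= pc, pc <= pd & pd <= 1] by split.
move=> pcgt; have h := pc_gt pcgt.
have cross : 2 * pc + 2 * (pd - pc - pd * pc) * (Cstar pd pc / 2) =
    pd + pc - pd * pc + (pd - pc) * (Cstar pd pc / 2).
  by rewrite /Cstar; field; rewrite gt_eqF //; lra.
move=> s1 s2; have [Mle|Mgt] := leP M (Cstar pd pc / 2).
  by have := ler_wpM2l (_ : 0 <= pd - pc) Mle; move=> /(_ ltac:(lra)); lra.
have : (pc + pd * pc - pd) * (Cstar pd pc / 2) <= (pc + pd * pc - pd) * M.
  by apply: ler_wpM2l; lra.
lra.
Qed.

(** With both parameters zero the common bits are constant and all information is private; [M] and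
    [Hxor] equal 1, so [rate_priv] is [pd * (1 - pc)]. *)
Lemma feasible_low : HK_feasible pd pc 0 0 0 (pd * (1 - pc)) 0 (pd * (1 - pc)).
Proof.
have [pc0' pcd' pd1'] : [/\ 0 <= pc, pc <= pd & pd <= 1] by split.
have z01 : 0 <= (0 : R) <= 1 by rewrite lexx ler01.
have r0 : 0 <= pd * (1 - pc) by rewrite mulr_ge0 //; lra.
apply/HK_feasibleP => //.
rewrite /rate_priv /rate_both /rate_direct /rate_cross /Mpriv Hpriv0 Hxor0.
by do !split => //; lra.
Qed.

(** Common rates sit at the cross-link bound and private rates at [rate_priv], where [M] is half of
    [Cstar] and [Hxor] equals [Cstar]. *)
Lemma feasible_high (d : R) : pd / (1 + pd) < pc ->
  0 <= d <= 1 -> Hpriv d = Cstar pd pc ->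
  let rc := rate_cross pd pc 1 d in
  HK_feasible pd pc 1 d rc (pd * Cstar pd pc / 2) rc (pd * Cstar pd pc / 2).
Proof.
have [pc0' pcd' pd1'] : [/\ 0 <= pc, pc <= pd & pd <= 1] by split.
move=> pcgt d01 dC rc; have /andP[C0 C1] := Cstar_itv pcgt.
have o01 : 0 <= (1 : R) <= 1 by rewrite lexx ler01.
have h := pc_gt pcgt.
have CE := Cstar_mul pcgt.
have rcE : rc = (1 - pd) * pc * (1 - Cstar pd pc / 2) + pd * pc * (1 - Cstar pd pc).
  by rewrite /rc /rate_cross /Mpriv Hpriv1 Hxor1 dC add0r.
have rc0 : 0 <= rc.
  by rewrite rcE; apply: addr_ge0; apply: mulr_ge0; rewrite ?mulr_ge0 //; lra.
have rp0 : 0 <= pd * Cstar pd pc / 2.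
  by rewrite divr_ge0 // mulr_ge0 ?(ltW C0) //; lra.
(* The cross link is the tighter one: [pc <= pd] gives [(1 - pd) * pc <= pd * (1 - pc)]. *)
have le_direct : rc <= rate_direct pd pc 1 d.
  rewrite /rc /rate_cross /rate_direct lerD2r; apply: ler_wpM2r; last by lra.
  by have /andP[] := Mpriv_itv o01 d01; lra.
apply/HK_feasibleP => //; split; first by split.
rewrite /rate_priv /rate_both /Mpriv Hpriv1 Hxor1 dC.
(* The equation [CE] says exactly that [2 * rc] equals [rate_both], so the joint bound holds with
   equality. *)
by split; [lra | lra | rewrite rcE; lra | split].
Qed.
End SumRate.

(** * The maximal sum rate in both interference regimes *)

Theorem theorem3 (R : realType) (pd pc : R) :
  0 <= pc -> pc <= pd -> pd <= 1 ->
  let V := if pc <= pd / (1 + pd) then 2 * pd * (1 - pc)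
           else pd + pc - pd * pc + (pd - pc) / 2 * Cstar pd pc in
  (forall d1 d2 : R, 0 <= d1 <= 1 -> 0 <= d2 <= 1 -> Rsum pd pc d1 d2 <= V) /\
  (exists d1 d2 : R, (0 <= d1 <= 1) /\ (0 <= d2 <= 1) /\ Rsum pd pc d1 d2 = V).
Proof.
move=> pc0 pcd pd1 V.
have pd01 : 0 < 1 + pd by lra.
have zo01 : (0 <= (0 : R) <= 1) * (0 <= (1 : R) <= 1) by rewrite !lexx ler01.
suff [ub [d1 [d2 [d101 [d201 lb]]]]] :
    (forall d1 d2 : R, 0 <= d1 <= 1 -> 0 <= d2 <= 1 -> Rsum pd pc d1 d2 <= V) /\
    (exists d1 d2 : R, 0 <= d1 <= 1 /\ 0 <= d2 <= 1 /\ V <= Rsum pd pc d1 d2).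
  split=> //; exists d1, d2; do !split => //.
  by apply/eqP; rewrite eq_le lb ub.
rewrite {}/V; have [pcle|pcgt] := leP pc (pd / (1 + pd)).
  have h : pc * (1 + pd) <= pd by rewrite -ler_pdivlMr.
  split=> [d1 d2 d101 d201|].
    apply: Rsum_le => [|r1c r1p r2c r2p /(feasible_sum_le pc0 pcd pd1 d101 d201)[s1 _]].
      by rewrite !mulr_ge0 //; lra.
    have /andP[_ M1] := Mpriv_itv d101 d201.
    (* Below the threshold the slope of the first bound in [M] is nonnegative, so its value at
       [M = 1] dominates. *)
    have := ler_wpM2l (_ : 0 <= pd - pc - pd * pc) M1.
    by move=> /(_ ltac:(lra)); lra.
  exists 0, 0; rewrite !zo01; do 2!split => //.
  have := Rsum_ge pc0 pcd pd1 zo01.1 zo01.1 (feasible_low pc0 pcd pd1).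
  lra.
have /andP[C0 C1] := Cstar_itv pc0 pcd pd1 pcgt.
split=> [d1 d2 d101 d201|].
  apply: Rsum_le => [|r1c r1p r2c r2p /(feasible_sum_le pc0 pcd pd1 d101 d201)[s1 s2]].
    have : 0 <= (pd - pc) / 2 * Cstar pd pc by rewrite mulr_ge0 ?(ltW C0) //; lra.
    have : 0 <= pd * (1 - pc) by rewrite mulr_ge0 //; lra.
    lra.
  exact: min_bounds_le s1 s2.
have [d d01 dC] := Hpriv_surj (Cstar_itv pc0 pcd pd1 pcgt).
(* Parameter 1 for one user makes [Hxor] equal to [2 * M], and [d] places [M] at the crossing of the
   two bounds. *)
exists 1, d; rewrite zo01; do 2!split => //.
have := Rsum_ge pc0 pcd pd1 zo01.2 d01 (feasible_high pc0 pcd pd1 pcgt d01 dC).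
apply: le_trans; rewrite /rate_cross /Mpriv Hpriv1 Hxor1 dC.
have CE := Cstar_mul pc0 pcd pd1 pcgt.
lra.
Qed.
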